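(* Let $(X,D)$ be an $\mathcal{F}$-metric space with $(f,\alpha)\in\mathcal{F}\times[0,\infty)$, and let $d$ be the metric on $X$ defined by $$d(x,y)=\inf\left\{\sum_{i=1}^{N-1}D(u_i,u_{i+1}) : N\in\mathbb{N},\ N\ge 2,\ \{u_i\}_{i=1}^{N}\subseteq X \text{ with } (u_1,u_N)=(x,y)\right\}.$$ Then a subset $A\subseteq X$ is $\mathcal{F}$-compact if and only if $A$ is compact with respect to the metric $d$.
   Context: $\mathcal{F}$ denotes the class of functions $f:(0,\infty)\to\mathbb{R}$ such that: ($\mathcal{F}_1$) $f$ is non-decreasing, i.e. $0<s<t$ implies $f(s)\le f(t)$; ($\mathcal{F}_2$) for every sequence $\{t_n\}_{n\in\mathbb{N}}\subseteq(0,\infty)$, $\lim_{n\to\infty}t_n=0$ if and only if $\lim_{n\to\infty}f(t_n)=-\infty$. Let $X$ be a non-empty set and $D:X\times X\to[0,\infty)$ a mapping. $(X,D)$ is an $\mathcal{F}$-metric space with $(f,\alpha)\in\mathcal{F}\times[0,\infty)$ if: (D1) for all $x,y\in X$, $D(x,y)=0$ if and only if $x=y$; (D2) $D(x,y)=D(y,x)$ for all $x,y\in X$; (D3) for every $(x,y)\in X\times X$, every $N\in\mathbb{N}$ with $N\ge 2$, and every $(u_i)_{i=1}^{N}\subseteq X$ with $(u_1,u_N)=(x,y)$, if $D(x,y)>0$ then $f(D(x,y))\le f\left(\sum_{i=1}^{N-1}D(u_i,u_{i+1})\right)+\alpha$. It is known that the function $d$ in the claim is then a metric on $X$. For $x\in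 X$, $r>0$ let $B_D(x,r)=\{y\in X: D(x,y)<r\}$. A set $O\subseteq X$ is $\mathcal{F}$-open if for every $x\in O$ there is $r>0$ with $B_D(x,r)\subseteq O$; the $\mathcal{F}$-open sets form the topology $\tau_{\mathcal{F}}$ on $X$. A subset $A\subseteq X$ is $\mathcal{F}$-compact if it is compact with respect to $\tau_{\mathcal{F}}$, i.e. every cover of $A$ by $\mathcal{F}$-open sets has a finite subcover. *)

(* Defs.v *)
(* MathComp-Analysis *)
From HB Require Import structures.
From mathcomp Require Import all_boot all_order all_algebra.
From mathcomp Require Import all_classical all_reals all_analysis.
From mathcomp Require Import zify lra.

Set Implicit Arguments.
Unset Strict Implicit.
Unset Printing Implicit Defensive.

Import Order.TTheory GRing.Theory Num.Theory.
Import numFieldNormedType.Exports.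

Local Open Scope classical_set_scope.
Local Open Scope ring_scope.

(* A function (0, +oo) -> R is a total function R -> R of which only the
   restriction to the positive reals is constrained or used. *)
Record class_F (R : realType) (f : R -> R) : Prop := {
  class_F_nondecreasing : forall s t : R, 0 < s -> s < t -> f s <= f t ;
  class_F_cvg : forall t : nat -> R, (forall n, 0 < t n) ->
    (t n @[n --> \oo] --> (0 : R)) <-> (f (t n) @[n --> \oo] --> -oo%R)
}.

(* A finite sequence u_1, ..., u_N is a function on nat of which only the
   values at 1, ..., N matter. *)
Definition is_chain (X : Type) (x y : X) (N : nat) (u : nat -> X) : Prop :=
  [/\ (2 <= N)%N, u 1%N = x & u N = y].

Definition chain_sum (R : realType) (X : Type) (D : X -> X -> R)
    (N : nat) (u : nat -> X) : R :=
  \sum_(1 <= i < N) D (u i) (u i.+1).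

Record F_metric_space (R : realType) (X : Type) (D : X -> X -> R)
    (f : R -> R) (alpha : R) : Prop := {
  F_metric_nonempty : inhabited X ;
  F_metric_class_F : class_F f ;
  F_metric_alpha_ge0 : 0 <= alpha ;
  F_metric_ge0 : forall x y, 0 <= D x y ;
  F_metric_eq0 : forall x y, D x y = 0 <-> x = y ;
  F_metric_sym : forall x y, D x y = D y x ;
  (* D x y > 0 and the axioms above make the chain sum positive, so f is
     only evaluated on its domain. *)
  F_metric_chain : forall (x y : X) (N : nat) (u : nat -> X),
    is_chain x y N u -> 0 < D x y -> f (D x y) <= f (chain_sum D N u) + alpha
}.

Definition chain_dist (R : realType) (X : Type) (D : X -> X -> R) (x y : X) : R :=
  inf [set s | exists N u, is_chain x y N u /\ s = chain_sum D N u].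

Definition F_ball (R : realType) (X : Type) (D : X -> X -> R) (x : X) (r : R)
  : set X := [set y | D x y < r].

Definition F_open (R : realType) (X : Type) (D : X -> X -> R) (O : set X) : Prop :=
  forall x, O x -> exists2 r : R, 0 < r & F_ball D x r `<=` O.

(* X with the topology of F-open sets. *)
Definition F_topological (R : realType) (X : Type) (D : X -> X -> R) : Type := X.

Section FTopology.
Context (R : realType) (X : Type) (D : X -> X -> R).

Lemma F_openT : F_open D setT.
Proof. by move=> x _; exists 1 => //; rewrite ltr01. Qed.

Lemma F_openI : setI_closed (F_open D).
Proof.
move=> A B oA oB x [Ax Bx].
have [r r0 rA] := oA x Ax; have [s s0 sB] := oB x Bx.
exists (Num.min r s); first by rewrite lt_min r0.
by move=> y; rewrite /F_ball /= lt_min => /andP[yr ys]; split; [exact: rA|exact: sB].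
Qed.

Lemma F_open_bigU (I : Type) (g : I -> set X) :
  (forall i, F_open D (g i)) -> F_open D (\bigcup_i g i).
Proof.
move=> og x [i _ gix]; have [r r0 rg] := og i x gix.
by exists r => // y /rg giy; exists i.
Qed.

HB.instance Definition _ := gen_eqMixin (F_topological D).
HB.instance Definition _ := gen_choiceMixin (F_topological D).
HB.instance Definition _ :=
  isOpenTopological.Build (F_topological D) F_openT F_openI F_open_bigU.

Lemma F_topologicalE (O : set X) :
  open (O : set (F_topological D)) <-> F_open D O.
Proof. by []. Qed.

End FTopology.

Section ChainDist.
Context (R : realType) (X : Type) (D : X -> X -> R) (f : R -> R) (alpha : R).
Hypothesis FM : F_metric_space D f alpha.

Lemma chain_sum_ge0 N u : 0 <= chain_sum D N u.
Proof. by apply: sumr_ge0 => i _; exact: (F_metric_ge0 FM). Qed.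

Let sums x y := [set s | exists N u, is_chain x y N u /\ s = chain_sum D N u].

Let pair_chain (x y : X) : is_chain x y 2 (fun i => if i == 1%N then x else y).
Proof. by split. Qed.

Lemma chain_dist_le x y N u :
  is_chain x y N u -> chain_dist D x y <= chain_sum D N u.
Proof.
move=> uP; apply: ge_inf; last by exists N, u.
by exists 0 => _ [M [v [_ ->]]]; exact: chain_sum_ge0.
Qed.

Let sums_inf x y : has_inf (sums x y).
Proof.
split; first by eexists; exists 2%N; eexists; split; first exact: pair_chain.
by exists 0 => _ [M [v [_ ->]]]; exact: chain_sum_ge0.
Qed.

Let chain_dist_lt x y e : 0 < e ->
  exists N u, is_chain x y N u /\ chain_sum D N u < chain_dist D x y + e.
Proof.
by move=> /inf_adherent /(_ (sums_inf x y))[_ [N [u [uP ->]]] h]; exists N, u.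
Qed.

Lemma chain_dist_ge0 x y : 0 <= chain_dist D x y.
Proof.
apply: lb_le_inf; first by case: (sums_inf x y).
by move=> _ [M [v [_ ->]]]; exact: chain_sum_ge0.
Qed.

Lemma chain_distxx x : chain_dist D x x = 0.
Proof.
apply/eqP; rewrite eq_le chain_dist_ge0 andbT.
rewrite (le_trans (chain_dist_le (pair_chain x x)))//.
by rewrite /chain_sum big_nat1/= (F_metric_eq0 FM x x).2.
Qed.

Let chain_sum_gt0 x y N u : is_chain x y N u -> x <> y -> 0 < chain_sum D N u.
Proof.
move=> [N2 u1 uN] xy; rewrite lt_neqAle chain_sum_ge0 andbT eq_sym.
apply/eqP => s0; apply: xy.
have D0 i : (1 <= i < N)%N -> D (u i) (u i.+1) = 0.
  move: s0; rewrite /chain_sum big_nat => /eqP.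
  rewrite psumr_eq0; last by move=> j _; exact: (F_metric_ge0 FM).
  move=> /allP h iN; apply/eqP; move: (h i); rewrite mem_index_iota => /(_ iN).
  by rewrite iN.
suff h k : (k < N)%N -> u k.+1 = x.
  by rewrite -uN -(h N.-1) ?prednK //; lia.
elim: k => // k IH kN; rewrite -(IH (ltnW kN)); apply/esym.
by apply/(F_metric_eq0 FM); apply: D0; rewrite kN.
Qed.

Lemma chain_dist_positivity x y : chain_dist D x y = 0 -> x = y.
Proof.
move=> d0; apply: contrapT => xy.
have Dxy : 0 < D x y.
  rewrite lt_neqAle (F_metric_ge0 FM) andbT eq_sym; apply/eqP.
  by move=> /(F_metric_eq0 FM).
have ex n : exists s : R, [/\ 0 < s, s < n.+1%:R^-1 & f (D x y) <= f s + alpha].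
  have n0 : 0 < n.+1%:R^-1 :> R by rewrite invr_gt0.
  have [N [u [uP us]]] := chain_dist_lt x y n0.
  exists (chain_sum D N u); split; first exact: chain_sum_gt0 uP xy.
    by rewrite d0 add0r in us.
  exact: (F_metric_chain FM).
have [t tP] := choice ex.
have t0 n : 0 < t n by case: (tP n).
have tcvg : t n @[n --> \oo] --> (0 : R).
  apply: (@squeeze_cvgr _ _ _ _ (cst 0) (@harmonic R)).
  - by apply: nearW => n; rewrite /cst ltW //=; case: (tP n) => _ /ltW.
  - exact: cvg_cst.
  - exact: cvg_harmonic.
have /cvgrNyPlt/(_ (f (D x y) - alpha)) :=
  (class_F_cvg (F_metric_class_F FM) t0).1 tcvg.
move=> [n _ /(_ n (leqnn n))]/=.
by case: (tP n) => _ _; lra.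
Qed.

Let chain_dist_le_sym x y : chain_dist D x y <= chain_dist D y x.
Proof.
apply: lb_le_inf; first by case: (sums_inf y x).
move=> _ [N [u [[N2 u1 uN] ->]]].
have vP : is_chain x y N (fun i => u (N.+1 - i)%N).
  by split => //; rewrite ?subSS ?subn0 ?subSnn.
apply: (le_trans (chain_dist_le vP)).
rewrite /chain_sum big_nat_rev/= le_eqVlt; apply/orP; left; apply/eqP.
apply: eq_big_nat => i /andP[i1 iN]; rewrite (F_metric_sym FM).
by congr (D (u _) (u _)); lia.
Qed.

Lemma chain_dist_sym x y : chain_dist D x y = chain_dist D y x.
Proof. by apply/eqP; rewrite eq_le !chain_dist_le_sym. Qed.

Lemma chain_dist_triangle y x z :
  chain_dist D x z <= chain_dist D x y + chain_dist D y z.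
Proof.
apply/ler_addgt0Pr => e e0; have e2 : 0 < e / 2 by lra.
have [N [u [[N2 u1 uN] us]]] := chain_dist_lt x y e2.
have [M [v [[M2 v1 vM] vs]]] := chain_dist_lt y z e2.
pose w i := if (i <= N)%N then u i else v (i - N.-1)%N.
have wP : is_chain x z (M + N.-1) w.
  split; first by lia.
    by rewrite /w ifT //; lia.
  by rewrite /w ifF ?addnK //; lia.
have ws : chain_sum D (M + N.-1) w = chain_sum D N u + chain_sum D M v.
  rewrite /chain_sum (@big_cat_nat _ _ _ N)//=; try lia.
  congr (_ + _).
    by apply: eq_big_nat => i /andP[i1 iN]; rewrite /w iN ltnW.
  rewrite -{1}[N](_ : (1 + N.-1 = N)%N); last by lia.
  rewrite big_addn addnK; apply: eq_big_nat => i /andP[i1 iN].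
  rewrite /w [X in D _ X]ifF; last by lia.
  congr (D _ (v _)); last by lia.
  case: ifPn => iN1; last by rewrite addnK.
  have -> : i = 1%N by lia.
  by rewrite v1 -uN; congr u; lia.
apply: (le_trans (chain_dist_le wP)); rewrite ws.
by lra.
Qed.

End ChainDist.

(* X with the metric chain_dist D; the F-metric axioms, needed to show that
   this is a metric, are a parameter of the type. *)
Definition chain_metric (R : realType) (X : Type) (D : X -> X -> R)
  (f : R -> R) (alpha : R) (FM : F_metric_space D f alpha) : Type := X.

Section ChainMetric.
Context (R : realType) (X : Type) (D : X -> X -> R) (f : R -> R) (alpha : R).
Context (FM : F_metric_space D f alpha).

HB.instance Definition _ := gen_eqMixin (chain_metric FM).
HB.instance Definition _ := gen_choiceMixin (chain_metric FM).
HB.instance Definition _ := isMetric.Build R (chain_metric FM)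
  (chain_distxx FM) (chain_dist_positivity FM) (chain_dist_sym FM)
  (chain_dist_triangle FM).

Lemma chain_metricE (x y : X) :
  mdist (x : chain_metric FM) (y : chain_metric FM) = chain_dist D x y.
Proof. by []. Qed.

Lemma chain_metric_openE (O : set X) :
  open (O : set (chain_metric FM)) <->
  forall x, O x -> exists2 r : R, 0 < r & [set y | chain_dist D x y < r] `<=` O.
Proof.
rewrite openE; split=> [oO x /oO|oO x /oO [r r0 rO]].
  move=> /(@nbhs_ballP R (chain_metric FM)) [r r0 rO]; by exists r.
by apply/(@nbhs_ballP R (chain_metric FM)); exists r.
Qed.

End ChainMetric.

(* Main.v *)
(** By [class_F_cvg], [f] is below any bound near [0], so a chain of small
    length forces [D x y] itself to be small; conversely the two-point chain
    gives [chain_dist D <= D]. Hence [D] and [chain_dist D] have the same open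
    sets, and compactness only refers to these. *)
Require Import Defs.
From mathcomp Require Import all_boot all_order all_algebra.
From mathcomp Require Import all_classical all_reals all_analysis.
From mathcomp Require Import lra.

Set Implicit Arguments.
Unset Strict Implicit.
Unset Printing Implicit Defensive.

Import Order.TTheory GRing.Theory Num.Theory.
Import numFieldNormedType.Exports.

Local Open Scope classical_set_scope.
Local Open Scope ring_scope.

(** Otherwise each [n] yields some [t n] in [(0, 1/(n+1))] with [M <= f (t n)]; then [t] tends to 0
    while [f (t n)] stays above [M], against [class_F_cvg]. *)
Lemma class_F_lt_near0 (R : realType) (f : R -> R) (M : R) :
  class_F f -> exists2 e : R, 0 < e & forall t, 0 < t < e -> f t < M.
Proof.
move=> fF; apply: contrapT => noe.
have ex n : exists t : R, [/\ 0 < t, t < n.+1%:R^-1 & M <= f t].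
  apply: contrapT => not; apply: noe.
  exists n.+1%:R^-1; first by rewrite invr_gt0.
  move=> t /andP[t0 tn]; rewrite ltNge; apply/negP => Mt.
  by apply: not; exists t.
have [t tP] := choice ex.
have t0 n : 0 < t n by case: (tP n).
have tcvg : t n @[n --> \oo] --> (0 : R).
  apply: (@squeeze_cvgr _ _ _ _ (cst 0) (@harmonic R)).
  - by apply: nearW => n; rewrite /cst ltW //=; case: (tP n) => _ /ltW.
  - exact: cvg_cst.
  - exact: cvg_harmonic.
have /cvgrNyPlt/(_ M)[n _ /(_ n (leqnn n))/=] := (class_F_cvg fF t0).1 tcvg.
by case: (tP n) => _ _; lra.
Qed.

Section SameTopology.
Context (R : realType) (X : Type) (D : X -> X -> R) (f : R -> R) (alpha : R).
Hypothesis FM : F_metric_space D f alpha.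

Lemma chain_dist_le_F x y : chain_dist D x y <= D x y.
Proof.
have xyP : is_chain x y 2 (fun i => if i == 1%N then x else y) by [].
by rewrite (le_trans (chain_dist_le FM xyP))// /chain_sum big_nat1.
Qed.

Lemma F_lt_of_chain_dist_lt (r : R) : 0 < r ->
  exists2 e : R, 0 < e & forall x y, chain_dist D x y < e -> D x y < r.
Proof.
move=> r0; have FF := F_metric_class_F FM.
(* The level [f r - alpha] absorbs the [alpha] of the chain inequality: a chain of sum below [e]
   gives [f (D x y) < f r], which monotonicity forbids if [r <= D x y]. *)
have [e e0 fe] := class_F_lt_near0 (f r - alpha) FF.
exists e => // x y dxy; rewrite ltNge; apply/negP => rD.
have Dxy : 0 < D x y by exact: lt_le_trans rD.
(* This keeps the chain sum found below positive, as [fe] demands. *)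
have d0 : 0 < chain_dist D x y.
  rewrite lt_neqAle (chain_dist_ge0 FM) andbT eq_sym; apply/eqP.
  move=> /(chain_dist_positivity FM) /(F_metric_eq0 FM) Dxy0.
  by rewrite Dxy0 ltxx in Dxy.
have [|_ [N [u [uP ->]]] ue] := inf_lt _ dxy.
  by eexists; exists 2%N, (fun i => if i == 1%N then x else y).
have s0 := lt_le_trans d0 (chain_dist_le FM uP).
have /fe := introT andP (conj s0 ue).
have := F_metric_chain FM uP Dxy.
have : f r <= f (D x y).
  move: rD; rewrite le_eqVlt => /predU1P[-> //|].
  exact: class_F_nondecreasing FF _ _ r0.
lra.
Qed.

(** Each ball of either kind contains one of the other kind with the same centre. *)
Lemma open_F_chain_metric (O : set X) :
  open (O : set (F_topological D)) <-> open (O : set (chain_metric FM)).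
Proof.
rewrite F_topologicalE chain_metric_openE; split => oO x /oO[r r0 rO].
  have [e e0 eP] := F_lt_of_chain_dist_lt r0.
  by exists e => // y /= /eP/rO.
by exists r => // y xy; apply: rO; exact: le_lt_trans (chain_dist_le_F x y) xy.
Qed.

End SameTopology.

Theorem theorem2p4 (R : realType) (X : Type) (D : X -> X -> R) (f : R -> R)
    (alpha : R) (FM : F_metric_space D f alpha) (A : set X) :
  cover_compact (A : set (F_topological D)) <->
  cover_compact (A : set (chain_metric FM)).
Proof.
(* Both sides quantify over the same families of open sets. *)
by split => cA I E g og; apply: cA => i Ei; apply/(open_F_chain_metric FM); exact: og.
Qed.
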